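(* Let $m\ge1$ and $[m]=\{1<2<\dots<m\}$. For every poset ideal $\mathcal{J}\subseteq\mathrm{Hom}([m],\mathbb{N})$ the projected co-letterplace ideal $L^{p_2}([m],\mathcal{J})$ is a strongly stable $m$-regular ideal of $k[x_0,x_1,x_2,\dots]$, and $\mathcal{J}\mapsto L^{p_2}([m],\mathcal{J})$ is a one-to-one correspondence between poset ideals of $\mathrm{Hom}([m],\mathbb{N})$ and finitely generated strongly stable $m$-regular ideals of $k[x_0,x_1,x_2,\dots]$.
   Context: $\mathbb{N}=\{0,1,2,\dots\}$; $\mathrm{Hom}([m],\mathbb{N})$ is the set of weakly increasing maps $[m]\to\mathbb{N}$ ordered pointwise. A marker for $\mathcal{J}$ is a poset ideal $I=\{1,\dots,r\}\subseteq[m]$ ($0\le r\le m$) with an isotone $\alpha:I\to\mathbb{N}$ such that every isotone $\phi:[m]\to\mathbb{N}$ with $\phi|_I=\alpha$ lies in $\mathcal{J}$; its graph is $\Gamma\alpha=\{(a,\alpha(a)):a\in I\}$. $k$ is a field; the co-letterplace ideal $L([m],\mathcal{J})\subseteq k[x_{a,i}:(a,i)\in[m]\times\mathbb{N}]$ is generated by $\prod_{(a,i)\in\Gamma\alpha}x_{a,i}$ over all markers $\alpha$. $L^{p_2}([m],\mathcal{J})$ is the ideal of $k[x_0,x_1,\dots]$ generated by the images of these generators under $x_{a,i}\mapsto x_i$. A monomial ideal is strongly stable if for every monomial $u$ and $i<j$, $x_ju\in I$ implies $x_iu\in I$. A finitely generated ideal is $m$-regular if its Castelnuovo–Mumford regularity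 (in a polynomial subring in finitely many variables containing its generators) is at most $m$. *)

(* Defs.v *)
From Stdlib Require List.
From mathcomp Require Import all_boot all_order all_algebra.
From mathcomp Require Import mpoly.
Set Implicit Arguments. Unset Strict Implicit. Unset Printing Implicit Defensive.
Import GRing.Theory.
Local Open Scope ring_scope.

(* Hom([m], N): [m] = {1 < ... < m} is encoded as 'I_m (i : 'I_m stands   *)
(* for the element i+1); maps [m] -> N are finite functions.              *)
Definition isotone (m : nat) (phi : {ffun 'I_m -> nat}) : Prop :=
  forall i j : 'I_m, (i <= j)%N -> (phi i <= phi j)%N.

Definition hom_poset_ideal (m : nat) (J : {ffun 'I_m -> nat} -> Prop) : Prop :=
  (forall phi, J phi -> isotone phi) /\
  (forall phi psi, J phi -> isotone psi -> (forall i, (psi i <= phi i)%N) -> J psi).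

(* A marker for J: the ideal I = {1..r} (r <= m) of [m] and an isotone    *)
(* alpha : I -> N (encoded by a finite function on 'I_m of which only the *)
(* values at i < r matter) such that every isotone phi extending alpha    *)
(* lies in J.                                                              *)
Definition is_marker (m : nat) (J : {ffun 'I_m -> nat} -> Prop)
  (r : nat) (alpha : {ffun 'I_m -> nat}) : Prop :=
  (r <= m)%N /\
  (forall i j : 'I_m, (i <= j)%N -> (j < r)%N -> (alpha i <= alpha j)%N) /\
  (forall phi, isotone phi -> (forall i : 'I_m, (i < r)%N -> phi i = alpha i) -> J phi).

(* Monomials of k[x_0, x_1, x_2, ...] are encoded by their exponent       *)
(* functions nat -> nat of finite support.  A monomial ideal is encoded   *)
(* by the set (predicate) of monomials it contains.                        *)
Definition monomial (u : nat -> nat) : Prop :=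
  exists N, forall i, (N <= i)%N -> u i = 0%N.

Definition mdivides (u v : nat -> nat) : Prop := forall i, (u i <= v i)%N.

Definition mulx (i : nat) (u : nat -> nat) : nat -> nat :=
  fun t => (u t + (t == i))%N.

(* Image of prod_{(a,i) in Gamma alpha} x_{a,i} under x_{a,i} |-> x_i:     *)
(* the monomial prod_{a < r} x_{alpha a}.                                   *)
Definition marker_monomial (m : nat) (r : nat) (alpha : {ffun 'I_m -> nat})
  : nat -> nat :=
  fun t => #|[set a : 'I_m | (a < r)%N && (alpha a == t)]|.

Definition Lp2 (m : nat) (J : {ffun 'I_m -> nat} -> Prop) (u : nat -> nat)
  : Prop :=
  monomial u /\
  exists r alpha, is_marker J r alpha /\ mdivides (marker_monomial r alpha) u.

Definition strongly_stable (M : (nat -> nat) -> Prop) : Prop :=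
  forall u i j, monomial u -> (i < j)%N -> M (mulx j u) -> M (mulx i u).

Definition generates (M : (nat -> nat) -> Prop) (gs : seq (nat -> nat)) : Prop :=
  (forall g, List.In g gs -> monomial g) /\
  (forall u, M u <-> (monomial u /\ exists2 g, List.In g gs & mdivides g u)).

Definition fin_gen_monomial_ideal (M : (nat -> nat) -> Prop) : Prop :=
  exists gs, generates M gs.

Section Regularity.
Variable (k : fieldType) (n : nat).
Local Notation S := {mpoly k[n]}.

Definition homog_deg (d : nat) (p : S) : bool :=
  all (fun mm => mdeg mm == d) (msupp p).

Definition in_ideal_gen (a : nat) (G : 'rV[S]_a) (p : S) : Prop :=
  exists v : 'cV[S]_a, p = (G *m v) ord0 ord0.

(* G (a row of generators of an ideal I of S) admits a finite graded free  *)
(* resolution                                                              *)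
(*   0 -> F_p -> ... -> F_1 -> F_0 -> I -> 0,                              *)
(*   F_i = (+)_j S(-deg i j),  rank F_i = r i,                             *)
(* (g : F_0 -> I the generator row, phi i : F_(i+1) -> F_i acting on column *)
(* vectors by matrices with homogeneous entries of the right degrees) in   *)
(* which every shift satisfies deg i j - i <= reg.  An ideal has           *)
(* Castelnuovo-Mumford regularity <= reg iff such a resolution exists      *)
(* (the minimal one is a direct summand of any graded free resolution).    *)
Definition has_regular_resolution (a : nat) (G : 'rV[S]_a) (reg : nat) : Prop :=
  exists (r : nat -> nat) (deg : forall i, 'I_(r i) -> nat)
         (g : 'rV[S]_(r 0%N)) (phi : forall i, 'M[S]_(r i, r i.+1)),
    (exists p, forall i, (p < i)%N -> r i = 0%N) /\
    (forall q, in_ideal_gen G q <-> in_ideal_gen g q) /\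
    (forall j, homog_deg (deg 0%N j) (g ord0 j)) /\
    (forall i a b, homog_deg (deg i.+1 b - deg i a) (phi i a b) /\
                   (phi i a b != 0 -> (deg i a <= deg i.+1 b)%N)) /\
    (forall v : 'cV[S]_(r 0%N), g *m v = 0 <-> exists w, v = phi 0%N *m w) /\
    (forall i (v : 'cV[S]_(r i.+1)), phi i *m v = 0 <-> exists w, v = phi i.+1 *m w) /\
    (forall i j, (deg i j <= reg + i)%N).

End Regularity.

Definition mon_of (n : nat) (u : nat -> nat) : 'X_{1..n} :=
  [multinom u (nat_of_ord i) | i < n].

Definition gen_row (k : fieldType) (n : nat) (gs : seq (nat -> nat))
  : 'rV[{mpoly k[n]}]_(size gs) :=
  \row_(j < size gs) 'X_[mon_of n (nth (fun _ => 0%N) gs j)].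

(* A finitely generated monomial ideal M of k[x_0, x_1, ...] is            *)
(* reg-regular: its regularity, computed in a polynomial subring           *)
(* k[x_0..x_{n-1}] containing its generators, is at most reg.              *)
Definition regular_monomial_ideal (k : fieldType) (reg : nat)
  (M : (nat -> nat) -> Prop) : Prop :=
  exists (gs : seq (nat -> nat)) (n : nat),
    generates M gs /\
    (forall g, List.In g gs -> forall i, (n <= i)%N -> g i = 0%N) /\
    has_regular_resolution (gen_row k n gs) reg.

Definition fg_strongly_stable_regular (k : fieldType) (reg : nat)
  (M : (nat -> nat) -> Prop) : Prop :=
  fin_gen_monomial_ideal M /\ strongly_stable M /\ regular_monomial_ideal k reg M.

(* Main.v *)
Require Import Defs.
From Stdlib Require Import Classical.
From mathcomp Require Import all_boot all_order all_algebra.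
From mathcomp Require Import mpoly zify.
Set Implicit Arguments. Unset Strict Implicit. Unset Printing Implicit Defensive.
Import GRing.Theory.

(* A monomial is a weakly increasing word.  Since J is down-closed, replacing
   the letters of a marker by smaller ones gives a marker again; hence a
   monomial lies in L^{p2}(J) iff some prefix of its sorted word is a marker.
   Strong stability follows, J is recovered as the set of words of length m
   in the ideal, and the minimal generators are the markers without a shorter
   marker prefix (there are finitely many of them: after a prefix that is not
   a marker only boundedly many next letters remain in J).

   For regularity, every monomial of the ideal is uniquely u w with u a minimal
   generator and w in the variables x_i, i >= max u.  Such a Pommaret basis
   h_j, with multiplicative variables x_i for i >= c_j, passes to syzygies: the
   relations s_(j,i) expressing x_i h_j (i < c_j) through the basis again form
   a Pommaret basis of the syzygy module, with classes i < c_j and degree one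
   higher.  As the classes drop, iterating yields a finite resolution whose
   shifts are at most m + i.  Conversely an m-regular monomial ideal is
   generated in degrees at most m, so it is L^{p2} of its words of length m. *)

(** * Pommaret bases and their syzygies *)

Local Open Scope ring_scope.

Section Involutive.
Variables (k : fieldType) (n : nat).
Local Notation S := {mpoly k[n]}.
Local Notation mon := 'X_{1..n}.

(** * Polynomials with prescribed support *)

Definition supp_in (Q : mon -> Prop) (p : S) : Prop :=
  forall e, e \in msupp p -> Q e.

Lemma supp_in0 Q : supp_in Q 0.
Proof. by move=> e; rewrite msupp0. Qed.

Lemma supp_inD Q p q : supp_in Q p -> supp_in Q q -> supp_in Q (p + q).
Proof.
by move=> hp hq e /msuppD_le; rewrite mem_cat => /orP[/hp|/hq].
Qed.

Lemma supp_inN Q p : supp_in Q p -> supp_in Q (- p).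
Proof. by move=> hp e; rewrite (perm_mem (msuppN p)) => /hp. Qed.

Lemma supp_inX (Q : mon -> Prop) e : Q e -> supp_in Q 'X_[e].
Proof. by move=> He e' /mem_msuppXP <-. Qed.

Lemma supp_inZ Q (x : k) p : supp_in Q p -> supp_in Q (x *: p).
Proof. by move=> hp e /msuppZ_le /hp. Qed.

Lemma supp_in_impl (Q Q' : mon -> Prop) p :
  (forall e, Q e -> Q' e) -> supp_in Q p -> supp_in Q' p.
Proof. by move=> h hp e /hp /h. Qed.

Lemma supp_inXM (Q Q' : mon -> Prop) e0 p :
  (forall e, Q e -> Q' (e0 + e)%MM) -> supp_in Q p -> supp_in Q' ('X_[e0] * p).
Proof.
move=> h hp e /msuppM_le /allpairsP[[e1 e2] /= [/mem_msuppXP <- /hp + ->]].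
exact: h.
Qed.

Lemma supp_in_False p : supp_in (fun=> False) p -> p = 0.
Proof.
rewrite /supp_in => hp; apply: msuppnil0.
by case: (msupp p) hp => // e s /(_ e (mem_head _ _)).
Qed.

Definition vars_ge (c : nat) (e : mon) : Prop :=
  forall i : 'I_n, (i < c)%N -> e i = 0%N.

Lemma mcoeff_sum (I : Type) (r : seq I) (A : pred I) (F : I -> S) e :
  (\sum_(i <- r | A i) F i)@_e = \sum_(i <- r | A i) (F i)@_e.
Proof. exact: raddf_sum. Qed.

Lemma mcoeff_mulX_eq0 (p : S) (e0 e : mon) :
  (forall e', e' \in msupp p -> (e' + e0)%MM <> e) -> (p * 'X_[e0])@_e = 0.
Proof.
move=> h; apply: contraTeq (eqxx e) => nz.
have : e \in msupp (p * 'X_[e0]) by rewrite mcoeff_msupp.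
move=> /msuppM_le /allpairsP[[e1 e2] /= [he1 /mem_msuppXP <- ee]].
by case: (h e1 he1).
Qed.

(** Every monomial of [f i * 'X_(x i)] has [x i] as its least variable, so distinct summands have
    disjoint supports and nothing cancels. *)
Lemma sum_mulX_min_var_eq0 (I : finType) (A : pred I) (x : I -> 'I_n)
    (f : I -> S) :
  {in A &, injective x} -> (forall i, A i -> supp_in (vars_ge (x i)) (f i)) ->
  \sum_(i | A i) f i * 'X_(x i) = 0 -> forall i, A i -> f i = 0.
Proof.
move=> xinj hf s0 i Ai; apply/mpolyP => e; rewrite mcoeff0.
case: (boolP (e \in msupp (f i))) => [he|]; last by rewrite -mcoeff_eq0 => /eqP.
have /(congr1 (mcoeff (U_(x i) + e)%MM)) := s0.
rewrite mcoeff0 mcoeff_sum (bigD1 i) //= mcoeffMX big1 ?addr0 // => j /andP[Aj ji].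
apply: mcoeff_mulX_eq0 => e' he' /mnmP heq.
have [hlt|hlt|/val_inj heq'] := ltngtP (x i) (x j).
- have := heq (x i); rewrite !mnmDE !mnm1E eqxx.
  by rewrite (hf j Aj e' he' (x i) hlt); case: eqP hlt => [->|]; rewrite ?ltnn.
- have := heq (x j); rewrite !mnmDE !mnm1E eqxx (hf i Ai e he (x j) hlt).
  by case: eqP hlt => [->|]; rewrite ?ltnn // addn1.
- by move/eqP: ji; apply; apply: xinj.
Qed.

(* The columns h_j of [H] satisfy: every element of their span is uniquely
   [sum_j p_j h_j] with [p_j] in [k[x_i : i >= c j]] (a Pommaret basis), and
   rewriting a product [x_i h_j], [i < c j], only involves columns of smaller
   [rho]; [d] is the degree of the columns. *)
Definition involutive_basis (a b : nat) (H : 'M[S]_(a, b)) (c rho d : 'I_b -> nat)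
  : Prop :=
  (forall v : 'cV[S]_b,
      (forall l, supp_in (vars_ge (c l)) (v l ord0)) -> H *m v = 0 -> v = 0) /\
  (forall (j : 'I_b) (i : 'I_n), (i < c j)%N ->
     exists v : 'cV[S]_b, H *m ('X_i *: delta_mx j ord0 - v) = 0 /\
       forall l, supp_in (fun e => vars_ge (c l) e /\ (rho l < rho j)%N /\
                            (mdeg e + d l)%N = (d j).+1) (v l ord0)).

(** The pairs (j, i) with x_i non-multiplicative for h_j are numbered so that they can index the
    columns of a syzygy matrix. *)
Lemma exists_index (b : nat) (c : 'I_b -> nat) :
  exists (b' : nat) (idx : 'I_b' -> 'I_b * 'I_n), injective idx /\
    (forall x, ((idx x).2 < c (idx x).1)%N) /\
    (forall (j : 'I_b) (i : 'I_n), (i < c j)%N -> exists x, idx x = (j, i)).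
Proof.
pose A := [pred y : 'I_b * 'I_n | (y.2 < c y.1)%N].
exists #|A|, (@enum_val _ A); split; first exact: enum_val_inj.
split=> [x|j i hji]; first exact: (enum_valP x).
have hA : (j, i) \in A by [].
by exists (enum_rank_in hA (j, i)); rewrite enum_rankK_in.
Qed.

(** * The syzygies of a Pommaret basis *)

Section Step.
Variables (a b : nat) (H : 'M[S]_(a, b)) (c rho d : 'I_b -> nat).
Hypothesis HU : forall v : 'cV[S]_b,
  (forall l, supp_in (vars_ge (c l)) (v l ord0)) -> H *m v = 0 -> v = 0.
Variable P : 'I_b * 'I_n -> 'cV[S]_b.
Hypothesis HP : forall y : 'I_b * 'I_n, (y.2 < c y.1)%N ->
  H *m ('X_(y.2) *: delta_mx y.1 ord0 - P y) = 0 /\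
  forall l, supp_in (fun e => vars_ge (c l) e /\ (rho l < rho y.1)%N /\
                     (mdeg e + d l)%N = (d y.1).+1) (P y l ord0).
Variables (b' : nat) (idx : 'I_b' -> 'I_b * 'I_n).
Hypothesis idx_inj : injective idx.
Hypothesis idx_lt : forall x, ((idx x).2 < c (idx x).1)%N.
Hypothesis idx_surj : forall (j : 'I_b) (i : 'I_n), (i < c j)%N ->
  exists x, idx x = (j, i).

Definition syz (y : 'I_b * 'I_n) : 'cV[S]_b :=
  'X_(y.2) *: delta_mx y.1 ord0 - P y.

Definition syzmx : 'M[S]_(b, b') := \matrix_(l, x) syz (idx x) l ord0.

Lemma syzmx_delta x : syzmx *m delta_mx x ord0 = syz (idx x).
Proof. by rewrite -colE; apply/colP=> l; rewrite !mxE. Qed.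

Lemma mul_syzmx : H *m syzmx = 0.
Proof.
apply/matrixP=> r x; have [+ _] := HP (idx_lt x).
move=> /matrixP/(_ r ord0); rewrite -/(syz _) -syzmx_delta mulmxA -colE.
by rewrite mxE [RHS]mxE => ->; rewrite mxE.
Qed.

Section Reduce.
Variable Q : 'I_b -> mon -> Prop.
Hypothesis Q_closed : forall l e l' e', Q l e -> (rho l' <= rho l)%N ->
  (mdeg e' + d l')%N = (mdeg e + d l)%N -> Q l' e'.

(** [Q] is an invariant of the reduction: trivial for [ker_syzmx], a bound on [rho] together with a
    fixed degree for [involutive_syzmx]. For [q] it is asked of x_i x^e, the term at h_j that x^e
    s_(j,i) eliminates. *)
Definition reducible (v : 'cV[S]_b) : Prop :=
  exists (v' : 'cV[S]_b) (q : 'cV[S]_b'), v = v' + syzmx *m q /\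
    (forall l, supp_in (fun e => vars_ge (c l) e /\ Q l e) (v' l ord0)) /\
    (forall x, supp_in (fun e => vars_ge (idx x).2 e /\
                 Q (idx x).1 (U_((idx x).2) + e)%MM) (q x ord0)).

Lemma reducible0 : reducible 0.
Proof.
exists 0, 0; rewrite mulmx0 addr0; split=> //.
by split=> l; rewrite mxE; apply: supp_in0.
Qed.

Lemma reducibleD v w : reducible v -> reducible w -> reducible (v + w).
Proof.
move=> [v1 [q1 [-> [hv1 hq1]]]] [v2 [q2 [-> [hv2 hq2]]]].
exists (v1 + v2), (q1 + q2); split; first by rewrite mulmxDr addrACA.
by split=> l; rewrite mxE; apply: supp_inD.
Qed.

Lemma reducibleZ (x : k) v : reducible v -> reducible (x%:MP *: v).
Proof.
move=> [v1 [q1 [-> [hv1 hq1]]]].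
exists (x%:MP *: v1), (x%:MP *: q1); rewrite scalerDr scalemxAr; split=> //.
by split=> l; rewrite mxE mul_mpolyC; apply: supp_inZ.
Qed.

Lemma reducible_sum (I : eqType) (r : seq I) (F : I -> 'cV[S]_b) :
  (forall i, i \in r -> reducible (F i)) -> reducible (\sum_(i <- r) F i).
Proof.
move=> hF; rewrite big_seq; elim/big_rec: _ => [|i v ri hv].
  exact: reducible0.
by apply: reducibleD => //; apply: hF.
Qed.

Lemma reducible_terms (v : 'cV[S]_b) :
  (forall l e, e \in msupp (v l ord0) ->
     reducible ('X_[e] *: delta_mx l ord0)) -> reducible v.
Proof.
move=> h.
have -> : v = \sum_(l <- index_enum 'I_b) \sum_(e <- msupp (v l ord0))
               ((v l ord0)@_e)%:MP *: ('X_[e] *: delta_mx l ord0).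
  rewrite [LHS]matrix_sum_delta; apply: eq_bigr => l _.
  rewrite big_ord1 {1}[v l ord0]mpolyE scaler_suml; apply: eq_bigr => e _.
  by rewrite scalerA mul_mpolyC.
apply: reducible_sum => l _; apply: reducible_sum => e he.
by apply/reducibleZ/h.
Qed.

(** If [e] contains a variable x_i non-multiplicative for h_l, subtracting a multiple of s_(l,i)
    replaces the term by terms of the same total degree and smaller [rho]. The induction is on a
    bound for [rho]. *)
Lemma reducible_term r : forall l e, (rho l < r)%N -> Q l e ->
  reducible ('X_[e] *: delta_mx l ord0).
Proof.
elim: r => // r IH l e hr hQ.
case: (pickP (fun i : 'I_n => (i < c l)%N && (e i != 0%N))) => [i0 hi0|hno]; last first.
  exists ('X_[e] *: delta_mx l ord0), 0; rewrite mulmx0 addr0; split=> //.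
  split=> l'; rewrite !mxE ?eqxx ?andbT; last exact: supp_in0.
  case: eqP => [->|_]; rewrite ?mulr1 ?mulr0; last exact: supp_in0.
  apply: supp_inX; split=> // i hi.
  by have := hno i; rewrite hi /= => /negbFE/eqP.
(* With [i] least, [e - U_(i)] only has variables of index at least [i], which are multiplicative
   for s_(l,i). *)
case: (@arg_minnP _ i0 (fun i : 'I_n => (i < c l)%N && (e i != 0%N))
         (fun i => i : nat) hi0) => i /andP[ic ei] imin.
have [x hx] := idx_surj ic.
pose e' := (e - U_(i))%MM.
have ee : e = (U_(i) + e')%MM.
  rewrite addmC submK //; apply/mnm_lepP=> j.
  by rewrite mnm1E; case: eqP => // <-; rewrite lt0n.
have hlow : vars_ge i e'.
  move=> j ji; rewrite mnmBE; apply/eqP; rewrite subn_eq0.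
  suff -> : e j = 0%N by [].
  apply/eqP; apply/negPn/negP => ej.
  have := imin j; rewrite ej (ltn_trans ji ic) => /(_ isT); by rewrite leqNgt ji.
have -> : 'X_[e] *: delta_mx l ord0 = 'X_[e'] *: syz (l, i) + 'X_[e'] *: P (l, i).
  by rewrite -scalerDr /syz /= subrK scalerA -mpolyXD addmC -ee.
apply: reducibleD.
  exists 0, ('X_[e'] *: delta_mx x ord0); split.
    by rewrite add0r -scalemxAr syzmx_delta hx.
  split=> y; rewrite !mxE ?eqxx ?andbT; first exact: supp_in0.
  case: eqP => [->|_]; rewrite ?mulr1 ?mulr0; last exact: supp_in0.
  by apply: supp_inX; rewrite hx /= -ee.
have [_ hP] := HP (y := (l, i)) ic.
apply: reducible_terms => l' e''; rewrite !mxE => he''.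
have : (rho l' < rho l)%N /\ (mdeg e'' + d l' = mdeg e + d l)%N.
  move: e'' he''; apply: supp_inXM (hP l') => e1 [_ [h1 h2]]; split=> //.
  by rewrite ee !mdegD mdeg1 /= in h2 *; lia.
case=> h1 h2; apply: IH; first by apply: leq_trans h1 _.
by apply: Q_closed hQ _ h2; apply: ltnW.
Qed.

Lemma reducible_of_supp (v : 'cV[S]_b) :
  (forall l, supp_in (Q l) (v l ord0)) -> reducible v.
Proof.
move=> hv; apply: reducible_terms => l e /hv hQ.
exact: reducible_term (ltnSn _) hQ.
Qed.

End Reduce.

(** A kernel vector is reduced modulo the syzygies. The remainder is again in the kernel and has
    multiplicative coefficients, so it vanishes by uniqueness. *)
Lemma ker_syzmx (v : 'cV[S]_b) : H *m v = 0 <-> exists w, v = syzmx *m w.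
Proof.
split=> [Hv|[w ->]]; last by rewrite mulmxA mul_syzmx mul0mx.
have [v' [q [e [hv' _]]]] := @reducible_of_supp (fun _ _ => True)
  (fun _ _ _ _ _ _ _ => I) v (fun _ _ _ => I).
exists q; rewrite e (HU (v := v')) ?add0r //.
  by move=> l; apply: supp_in_impl (hv' l) => ? [].
by move: Hv; rewrite e mulmxDr mulmxA mul_syzmx mul0mx addr0.
Qed.

Lemma syz_coef y l : syz y l ord0 = 'X_(y.2) * (l == y.1)%:R - P y l ord0.
Proof. by rewrite /syz !mxE eqxx andbT. Qed.

(** Row j of the relation holds the terms x_i q_(j,i) and contributions of [P] from columns with
    larger [rho]. Once the latter vanish, the former are separated by their least variables. *)
Lemma syzmx_inj (q : 'cV[S]_b') :
  (forall x, supp_in (vars_ge (idx x).2) (q x ord0)) -> syzmx *m q = 0 -> q = 0.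
Proof.
move=> hq s0; pose R := (\max_(j < b) rho j)%N.
(* [t] bounds the distance of [rho] from its maximum, so the induction runs through decreasing
   [rho]. *)
have main : forall t x, (R - rho (idx x).1 < t)%N -> q x ord0 = 0.
  elim=> // t IH x hx.
  have := congr1 (fun M : 'cV[S]_b => M (idx x).1 ord0) s0; rewrite /= !mxE.
  rewrite (bigID (fun y => (idx y).1 == (idx x).1)) /= [X in _ + X]big1 ?addr0.
    move=> hs; apply: (@sum_mulX_min_var_eq0 _ [pred y | (idx y).1 == (idx x).1]
       (fun y => (idx y).2) (fun y => q y ord0) _ _ _ x (eqxx _)) => //.
      move=> y z /eqP hy /eqP hz yz; apply: idx_inj.
      by rewrite [idx y]surjective_pairing [idx z]surjective_pairing hy hz yz.
    rewrite -[RHS]hs; apply: eq_bigr => y /eqP hy.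
    rewrite mxE syz_coef hy eqxx mulr1.
    suff -> : P (idx y) (idx x).1 ord0 = 0 by rewrite subr0 mulrC.
    have [_ /(_ (idx x).1) hP] := HP (idx_lt y).
    by apply: supp_in_False; apply: supp_in_impl hP => e [_ []]; rewrite hy ltnn.
  move=> y hy; rewrite mxE syz_coef eq_sym (negbTE hy) mulr0 sub0r.
  have [_ /(_ (idx x).1) hP] := HP (idx_lt y).
  have [hr|hr] := ltnP (rho (idx x).1) (rho (idx y).1).
    rewrite (IH y) ?mulr0 //.
    have : (rho (idx y).1 <= R)%N by apply: leq_bigmax.
    by move: hx hr; lia.
  suff -> : P (idx y) (idx x).1 ord0 = 0 by rewrite oppr0 mul0r.
  apply: supp_in_False; apply: supp_in_impl hP => e [_ []].
  by rewrite ltnNge hr.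
by apply/colP=> x; rewrite mxE (main _ x (ltnSn _)).
Qed.

(** For t < i the terms at h_j cancel in x_t s_(j,i) - x_i s_(j,t). The difference reduces to
    syzygies of smaller [rho], and x_i is multiplicative for s_(j,t). The new [rho] encodes the
    lexicographic order on (rho j, i), which also drops from (j, i) to (j, t). *)
Lemma involutive_syzmx :
  involutive_basis syzmx (fun x => (idx x).2 : nat)
    (fun x => (rho (idx x).1 * n.+1 + (idx x).2)%N) (fun x => (d (idx x).1).+1).
Proof.
split; first exact: syzmx_inj.
move=> x t; case hx: (idx x) => [j i] /= ti.
have ic : (i < c j)%N by have := idx_lt x; rewrite hx.
have tc : (t < c j)%N by apply: ltn_trans ti ic.
have [x' hx'] := idx_surj tc.
pose v : 'cV[S]_b := 'X_i *: P (j, t) - 'X_t *: P (j, i).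
have ev : 'X_t *: syz (j, i) = 'X_i *: syz (j, t) + v.
  rewrite /syz /v !scalerBr !scalerA /= ['X_t * 'X_i]mulrC.
  by rewrite -[in RHS]addrA [_ + (_ - _)]addrA addNr add0r.
pose Q l (e : mon) := (rho l < rho j)%N /\ (mdeg e + d l)%N = (d j).+2 :> nat.
have hP (s : 'I_n) (s' : 'I_n) l : (s < c j)%N ->
    supp_in (Q l) (('X_s' *: P (j, s)) l ord0).
  move=> sc; rewrite mxE; have [_ /(_ l) hPs] := HP (y := (j, s)) sc.
  apply: supp_inXM hPs => e [_ [h1 h2]]; split=> //.
  by rewrite mdegD mdeg1 /= in h2 *; lia.
have Qcl l e l' e' : Q l e -> (rho l' <= rho l)%N ->
    (mdeg e' + d l')%N = (mdeg e + d l)%N -> Q l' e'.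
  by move=> [h1 h2] h3 h4; split; [apply: leq_ltn_trans h3 h1 | rewrite h4].
have hv l : supp_in (Q l) (v l ord0).
  rewrite /v mxE; apply: supp_inD; first exact: hP.
  rewrite mxE; apply: supp_inN; exact: hP.
have [v' [q [evq [hv' hq]]]] := reducible_of_supp Qcl hv.
have Hsyz (s : 'I_n) : (s < c j)%N -> H *m syz (j, s) = 0.
  by move=> sc; have [] := HP (y := (j, s)) sc.
have v'0 : v' = 0.
  apply: HU => [l|]; first by apply: supp_in_impl (hv' l) => ? [].
  have : H *m v = 0.
    have /(congr1 (mulmx H)) := ev.
    by rewrite mulmxDr -!scalemxAr !Hsyz // !scaler0 add0r.
  by rewrite evq mulmxDr mulmxA mul_syzmx mul0mx addr0.
exists ('X_i *: delta_mx x' ord0 + q); split.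
  rewrite mulmxBr mulmxDr -!scalemxAr !syzmx_delta hx hx' ev evq v'0 add0r.
  by rewrite subrr.
move=> y; rewrite !mxE eqxx andbT; apply: supp_inD.
  case: eqP => [->|_]; rewrite ?mulr1 ?mulr0; last exact: supp_in0.
  apply: supp_inX; rewrite hx' /= mdeg1; split; last by split; lia.
  by move=> s st; rewrite mnm1E; case: eqP ti => // ->; lia.
apply: supp_in_impl (hq y) => e [he [h1 h2]]; split=> //.
have := ltn_ord (idx y).2; rewrite mdegD mdeg1 in h2.
by move=> h3; split; [nia|lia].
Qed.

End Step.

(* [deg] and [r] describe [F_1, F_2, ...]; [H : F_0 -> S^a] itself is not part
   of the data. *)
Definition resolves_ker (a b : nat) (H : 'M[S]_(a, b)) (d : 'I_b -> nat)
    (reg : nat) : Prop :=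
  exists (r : nat -> nat) (deg : forall i, 'I_(r i) -> nat)
         (psi : 'M[S]_(b, r 0%N)) (phi : forall i, 'M[S]_(r i, r i.+1)),
    [/\ exists p, forall i, (p < i)%N -> r i = 0%N,
        forall x y, supp_in (fun e => mdeg e + d x = deg 0 y)%N (psi x y) &
        forall i x y, supp_in (fun e => mdeg e + deg i x = deg i.+1 y)%N (phi i x y)] /\
    [/\ forall v : 'cV[S]_b, H *m v = 0 <-> exists w, v = psi *m w,
        forall v : 'cV[S]_(r 0%N), psi *m v = 0 <-> exists w, v = phi 0%N *m w,
        forall i (v : 'cV[S]_(r i.+1)), phi i *m v = 0 <-> exists w, v = phi i.+1 *m w &
        forall i j, (deg i j <= reg + i)%N].

(** Induction on a bound for the classes: the class i of s_(j,i) is smaller than [c j]. The bound on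
    [d] is strict because [deg 0] belongs to F_1, whose shifts are [d j + 1]. *)
Lemma involutive_resolves_ker C : forall a b (H : 'M[S]_(a, b)) c rho d reg,
  involutive_basis H c rho d -> (forall j, c j < C)%N -> (forall j, d j < reg)%N ->
  resolves_ker H d reg.
Proof.
elim: C => [|C IH] a b H c rho d reg [HU HE] hC hd.
  (* No class is below 0, so [H] has no columns and the zero complex serves. *)
  exists (fun=> 0%N), (fun _ _ => 0%N), 0, (fun=> 0); split.
    by split=> [|x []|i []] //; exists 0%N.
  split=> [v|v|i v|i []] //; try by split=> [_|_];
    [exists 0; apply/matrixP=> -[] | rewrite mul0mx].
  have v0 : v = 0 by apply/colP=> x; have := hC x.
  by split=> _; [exists 0; rewrite mulmx0 | rewrite v0 mulmx0].
have /fin_all_exists [P HP] : forall y : 'I_b * 'I_n, exists v : 'cV[S]_b,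
  (y.2 < c y.1)%N -> H *m ('X_(y.2) *: delta_mx y.1 ord0 - v) = 0 /\
  forall l, supp_in (fun e => vars_ge (c l) e /\ (rho l < rho y.1)%N /\
                     (mdeg e + d l)%N = (d y.1).+1) (v l ord0).
  move=> [j i] /=; case: (ltnP i (c j)) => [/HE[v hv]|_]; last by exists 0.
  by exists v.
have [b' [idx [idx_inj [idx_lt idx_surj]]]] := exists_index c.
have inv' := involutive_syzmx HU HP idx_inj idx_lt idx_surj.
have kerH := ker_syzmx HU HP idx_lt idx_surj.
(* The syzygies have degree [d j + 1 <= reg], hence the strict bound [reg.+1]; it fits since
   [reg.+1 + i = reg + i.+1]. *)
have [||r [deg [psi [phi [[[p hp] dpsi dphi] [e0 e1 e2 hdeg]]]]]] :=
  IH _ _ _ _ _ _ reg.+1 inv'.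
- by move=> x; have := hC (idx x).1; have := idx_lt x; lia.
- by move=> x; rewrite ltnS.
exists (fun i => if i is i'.+1 then r i' else b').
exists (fun i => match i return 'I_(if i is i'.+1 then r i' else b') -> nat with
   | 0 => fun x => (d (idx x).1).+1 | i'.+1 => deg i' end).
exists (syzmx P idx).
exists (fun i => match i return 'M[S]_(if i is i'.+1 then r i' else b', r i) with
   | 0 => psi | i'.+1 => phi i' end).
split; split=> //.
- by exists p.+1 => -[|i] //; apply: hp.
- move=> x y; rewrite mxE syz_coef; apply: supp_inD.
    case: eqP => [->|_]; rewrite ?mulr1 ?mulr0; last exact: supp_in0.
    by apply: supp_inX; rewrite mdeg1 add1n.
  apply: supp_inN; have [_ h] := HP _ (idx_lt y).
  by apply: supp_in_impl (h x) => e [_ []].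
- by move=> [|i] x y.
- by move=> [|i] v.
- move=> [|i] j; first by rewrite addn0; apply: hd.
  by have := hdeg i j; rewrite addSn addnS.
Qed.

(** Passes from the degree equation, stable under sums and products, to the truncated difference and
    the inequality in the definition of a resolution. *)
Lemma supp_in_homog D e p : supp_in (fun m => mdeg m + e = D)%N p ->
  homog_deg (D - e) p /\ (p != 0 -> (e <= D)%N).
Proof.
move=> hp; split.
  by apply/allP=> m /hp <-; rewrite addnK.
rewrite -msupp_eq0; rewrite /supp_in in hp.
case: (msupp p) hp => // m s /(_ m (mem_head _ _)) <- _.
exact: leq_addl.
Qed.

Lemma involutive_has_regular_resolution b (g : 'rV[S]_b) c rho d reg :
  involutive_basis g c rho d -> (forall j, homog_deg (d j) (g ord0 j)) ->
  (forall j, d j <= reg)%N -> has_regular_resolution g reg.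
Proof.
move=> inv hg hd.
have hC j : (c j < (\max_j c j).+1)%N by rewrite ltnS leq_bigmax.
have [//|r [deg [psi [phi [[[p hp] dpsi dphi] [e0 e1 e2 hdeg]]]]]] :=
  involutive_resolves_ker (reg := reg.+1) inv hC.
exists (fun i => if i is i'.+1 then r i' else b).
exists (fun i => match i return 'I_(if i is i'.+1 then r i' else b) -> nat with
   | 0 => d | i'.+1 => deg i' end).
exists g.
exists (fun i => match i return 'M[S]_(if i is i'.+1 then r i' else b, r i) with
   | 0 => psi | i'.+1 => phi i' end).
split; first by exists p.+1 => -[|i] //; apply: hp.
split=> //; split=> //.
split; first by move=> [|i] x y; apply: supp_in_homog.
split=> //; split; first by move=> [|i] v.
move=> [|i] j; first by rewrite addn0.
by have := hdeg i j; rewrite addSn addnS.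
Qed.

End Involutive.

(** * Markers as sorted words *)

Local Open Scope nat_scope.

(** In a sorted word the letters at most [v] form a prefix. Counting them thus compares sorted words
    letter by letter without tracking positions. *)
Lemma leq_nth_count s i v : sorted leq s -> (i < size s)%N ->
  (nth 0%N s i <= v)%N = (i < count (leq^~ v) s)%N.
Proof.
elim: s i => // x s IH i /= xs; have ss := path_sorted xs.
have hall := order_path_min leq_trans xs.
case: i => [_|i].
  rewrite /=; case: (leqP x v) => [//|vx] /=; rewrite add0n -has_count.
  apply/esym/negbTE; apply/hasPn => y /(allP hall); lia.
rewrite ltnS => hi; rewrite /= IH //; case: (leqP x v) => [//|vx] /=.
have -> : count (leq^~ v) s = 0%N; last by [].
apply/eqP; rewrite -leqn0 leqNgt -has_count; apply/hasPn => y /(allP hall); lia.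
Qed.

Lemma nth_leq_of_count s s' : sorted leq s -> sorted leq s' ->
  (forall v, count (leq^~ v) s <= count (leq^~ v) s')%N ->
  forall i, (i < size s)%N -> (i < size s')%N -> (nth 0%N s' i <= nth 0%N s i)%N.
Proof.
move=> ss ss' h i hi hi'; rewrite leq_nth_count //.
by apply: leq_trans (h _); rewrite -leq_nth_count.
Qed.

Definition mdiv_seq (s t : seq nat) : Prop :=
  forall x, (count_mem x s <= count_mem x t)%N.

Lemma mdiv_seq_size s t : mdiv_seq s t -> (size s <= size t)%N.
Proof.
move=> /count_subseqP[s' hs /perm_size ->]; exact: size_subseq.
Qed.

(** Up to permutation [s] is a subword of [t], so it has at most as many letters below any bound. *)
Lemma mdiv_seq_nth s t : sorted leq s -> sorted leq t -> mdiv_seq s t ->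
  forall i, (i < size s)%N -> (nth 0%N t i <= nth 0%N s i)%N.
Proof.
move=> ss st h i hi; apply: nth_leq_of_count => //; last first.
  exact: leq_trans hi (mdiv_seq_size h).
move/count_subseqP: h => [s' hs /permP hp] v.
by rewrite hp; apply: leq_count_subseq.
Qed.

Lemma monomial_seq u : monomial u ->
  exists2 s, sorted leq s & forall t, count_mem t s = u t.
Proof.
move=> [N hN]; exists (sort leq (flatten [seq nseq (u t) t | t <- iota 0 N])).
  exact: sort_sorted leq_total _.
move=> t; rewrite (permP (permEl (perm_sort _ _))) count_flatten -map_comp.
rewrite sumnE big_map.
have [tN|tN] := ltnP t N; last first.
  rewrite hN // big_seq big1 // => i; rewrite mem_iota /= add0n => iN.
  by rewrite count_nseq /=; case: eqP => //; lia.
rewrite (bigD1_seq t) ?iota_uniq ?mem_iota //= count_nseq /= eqxx mul1n.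
by rewrite big1 ?addn0 // => i it; rewrite count_nseq /= (negbTE it) mul0n.
Qed.

Definition seq_exp (s : seq nat) : nat -> nat := fun t => count_mem t s.

Lemma monomial_seq_exp s : monomial (seq_exp s).
Proof.
exists (\max_(x <- s) x).+1 => i hi; apply/count_memPn/negP => /seq.nthP.
move=> /(_ 0%N) [j js hj].
have : (i <= \max_(x <- s) x)%N; last by lia.
by rewrite -hj; apply: (leq_bigmax_seq (F := id)) => //; apply: mem_nth.
Qed.

Section Markers.
Variable m : nat.

Definition seq_hom (s : seq nat) : {ffun 'I_m -> nat} := [ffun i : 'I_m => nth 0%N s i].

Lemma isotone_seq_hom s : sorted leq s -> size s = m -> isotone (seq_hom s).
Proof.
move=> ss zs i j ij; rewrite !ffunE.
by apply: (sorted_leq_nth leq_trans leqnn) => //; rewrite inE zs.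
Qed.

Lemma size_codom_ord (phi : {ffun 'I_m -> nat}) : size (codom phi) = m.
Proof. by rewrite size_codom card_ord. Qed.

Lemma nth_codom_ord (phi : {ffun 'I_m -> nat}) (i : 'I_m) :
  nth 0%N (codom phi) i = phi i.
Proof.
by rewrite (nth_map i) ?size_enum_ord // nth_ord_enum.
Qed.

Lemma codom_ordK (phi : {ffun 'I_m -> nat}) : seq_hom (codom phi) = phi.
Proof. by apply/ffunP=> i; rewrite ffunE nth_codom_ord. Qed.

Lemma seq_homK t : size t = m -> codom (seq_hom t) = t.
Proof.
move=> zt; apply: (@eq_from_nth _ 0%N); rewrite size_codom_ord // => i im.
by rewrite -[i]/(val (Ordinal im)) nth_codom_ord ffunE.
Qed.

Lemma isotone_sorted (phi : {ffun 'I_m -> nat}) : isotone phi -> sorted leq (codom phi).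
Proof.
move=> hphi; apply/(sortedP 0%N) => i; rewrite size_codom_ord => hi.
have := hphi (Ordinal (ltnW hi)) (Ordinal hi) (leqnSn i).
by rewrite -!nth_codom_ord.
Qed.

Lemma marker_monomialE r (alpha : {ffun 'I_m -> nat}) t : (r <= m)%N ->
  marker_monomial r alpha t = count_mem t (take r (codom alpha)).
Proof.
move=> rm; rewrite /marker_monomial -sum1_card -sum1_count.
rewrite [RHS]big_mkcond (big_nth 0%N) size_takel ?size_codom_ord // big_mkord.
rewrite (big_ord_widen m
  (fun i => if nth 0 (take r (codom alpha)) i == t then 1 else 0)%N rm).
rewrite [LHS]big_mkcond [RHS]big_mkcond; apply: eq_bigr => i _.
by rewrite inE; case: ltnP => // ir; rewrite nth_take // nth_codom_ord.
Qed.

Lemma take_eq_nth (s t : seq nat) : (size s <= size t)%N ->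
  (forall i, (i < size s)%N -> nth 0%N t i = nth 0%N s i) -> take (size s) t = s.
Proof.
move=> st h; apply: (@eq_from_nth _ 0%N); first by rewrite size_takel.
by move=> i; rewrite size_takel // => hi; rewrite nth_take // h.
Qed.

Lemma sorted_mkseq f r : {homo f : i j / (i <= j)%N} -> sorted leq (mkseq f r).
Proof.
move=> hf; apply/(sortedP 0%N) => i; rewrite size_mkseq => hi.
by rewrite !nth_mkseq ?(ltnW hi) //; apply: hf.
Qed.

(** With the last letter as default, the word is continued by a constant tail; this fills words up
    to length m. *)
Lemma nth_last_homo s : sorted leq s ->
  {homo nth (last 0%N s) s : i j / (i <= j)%N}.
Proof.
move=> ss i j ij; have [js|js] := ltnP j (size s).
  by apply: (sorted_leq_nth leq_trans leqnn) => //; rewrite inE; lia.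
rewrite [X in (_ <= X)%N]nth_default //.
have [is_|is_] := ltnP i (size s); last by rewrite nth_default.
rewrite (set_nth_default 0%N) // -nth_last.
by apply: (sorted_leq_nth leq_trans leqnn) => //; rewrite ?inE; lia.
Qed.

(** The word of values of a marker: its length is r, and the values of [alpha] outside the ideal
    {1..r} disappear. *)
Definition seq_marker (J : {ffun 'I_m -> nat} -> Prop) (s : seq nat) : Prop :=
  [/\ (size s <= m)%N, sorted leq s &
      forall t, sorted leq t -> size t = m -> take (size s) t = s -> J (seq_hom t)].

Lemma Lp2_seq_markerP J u : monomial u ->
  (Lp2 J u <-> exists2 s, seq_marker J s & forall x, (count_mem x s <= u x)%N).
Proof.
move=> mu; split=> [[_ [r [alpha [[rm [iso hJ]] hdiv]]]]|[s [sm ss hs] hdiv]].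
  have zs : size (take r (codom alpha)) = r by rewrite size_takel ?size_codom_ord.
  exists (take r (codom alpha)); last first.
    by move=> x; rewrite -marker_monomialE //; apply: hdiv.
  split; first by rewrite zs.
    apply/(sortedP 0%N) => i; rewrite zs => hi; rewrite !nth_take ?(ltnW hi) //.
    have hi1 : (i.+1 < m)%N by apply: leq_trans hi rm.
    have := iso (Ordinal (ltnW hi1)) (Ordinal hi1) (leqnSn i) hi.
    by rewrite -!nth_codom_ord.
  move=> t st zt; rewrite zs => ht; apply: hJ; first exact: isotone_seq_hom.
  by move=> i ir; rewrite ffunE -(nth_take 0%N ir) ht nth_take // nth_codom_ord.
split=> //; exists (size s), (seq_hom s).
have ts : take (size s) (codom (seq_hom s)) = s.
  apply: take_eq_nth; rewrite ?size_codom_ord // => i hi.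
  have im : (i < m)%N by apply: leq_trans hi sm.
  by rewrite -[i]/(val (Ordinal im)) nth_codom_ord ffunE.
split; last by move=> x; rewrite marker_monomialE // ts.
split=> //; split=> [i j ij js|phi iso hphi].
  rewrite !ffunE; apply: (sorted_leq_nth leq_trans leqnn) => //.
  by rewrite inE; apply: leq_ltn_trans ij js.
rewrite -[phi]codom_ordK; apply: hs; first exact: isotone_sorted.
  exact: size_codom_ord.
apply: take_eq_nth; rewrite ?size_codom_ord // => i hi.
have im : (i < m)%N by apply: leq_trans hi sm.
by rewrite -[i]/(val (Ordinal im)) nth_codom_ord hphi // ffunE.
Qed.

(** * Marker prefixes and strong stability *)

Section PosetIdeal.
Variable J : {ffun 'I_m -> nat} -> Prop.
Hypothesis HJ : hom_poset_ideal J.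

Lemma seq_hom_down s t : sorted leq s -> size s = m ->
  (forall i, (i < m)%N -> (nth 0%N s i <= nth 0%N t i)%N) ->
  J (seq_hom t) -> J (seq_hom s).
Proof.
move=> ss zs h Jt; apply: (HJ.2 _ _ Jt); first exact: isotone_seq_hom.
by move=> i; rewrite !ffunE; apply: h.
Qed.

(** Every extension of [s'] lies below some extension of [s], and [J] is closed downwards. *)
Lemma seq_marker_down s s' : seq_marker J s -> sorted leq s' ->
  size s' = size s -> (forall i, (i < size s)%N -> (nth 0%N s' i <= nth 0%N s i)%N) ->
  seq_marker J s'.
Proof.
move=> [sm ss hs] ss' zs' h; split=> //; first by rewrite zs'.
move=> t' st' zt' ht'.
(* The maximum of [t'] and [s] with a constant tail: it dominates [t'], and it begins with [s]
   because [s'] lies below [s]. *)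
pose f i := maxn (nth (last 0%N s) s i) (nth (last 0%N t') t' i).
have st : sorted leq (mkseq f m).
  apply: sorted_mkseq => i j ij; rewrite /f.
  by have := nth_last_homo ss ij; have := nth_last_homo st' ij; lia.
apply: (@seq_hom_down t' (mkseq f m)) => //.
  by move=> i im; rewrite nth_mkseq // /f (set_nth_default (last 0%N t')) ?zt' // leq_maxr.
apply: hs => //; first by rewrite size_mkseq.
apply: take_eq_nth; rewrite ?size_mkseq // => i hi.
have im : (i < m)%N by apply: leq_trans hi sm.
rewrite nth_mkseq // /f (set_nth_default 0%N) //.
rewrite (set_nth_default 0%N (last 0%N t')) ?zt' //; apply/maxn_idPl.
by rewrite -(@nth_take (size s') _ _ i) ?zs' // -zs' ht'; apply: h.
Qed.

(** Turns divisibility by a marker into having a marker as prefix: the first letters of [t] lie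
    below those of [s]. *)
Lemma seq_marker_prefix s t : seq_marker J s -> sorted leq t -> mdiv_seq s t ->
  seq_marker J (take (size s) t).
Proof.
move=> ms st st'; have [_ ss _] := ms.
have zs := mdiv_seq_size st'.
apply: (seq_marker_down ms); rewrite ?size_takel //.
  exact: (subseq_sorted leq_trans (take_subseq _ _) st).
by move=> i hi; rewrite nth_take //; apply: mdiv_seq_nth.
Qed.

Lemma Lp2_monomial u : Lp2 J u -> monomial u.
Proof. by case. Qed.

Lemma monomial_mulx i u : monomial u -> monomial (mulx i u).
Proof.
move=> [N hN]; exists (maxn N i.+1) => x hx; rewrite /mulx hN; last by lia.
by case: eqP => //; lia.
Qed.

(** If the marker dividing x_j u needs the additional x_j, one of its letters j is replaced by i and
    the word is sorted again. *)
Lemma Lp2_strongly_stable : strongly_stable (Lp2 J).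
Proof.
move=> u i j mu ij hu.
apply/(Lp2_seq_markerP _ (monomial_mulx i mu)).
have [s ms hs] := (Lp2_seq_markerP J (monomial_mulx j mu)).1 hu.
have [hj|hj] := leqP (count_mem j s) (u j).
  exists s => // x; have := hs x; rewrite /mulx; case: (x =P j) => [->|_]; lia.
have js : j \in s by rewrite -has_pred1 has_count; lia.
have /permP hp := perm_to_rem js.
have /permP hp' := permEl (perm_sort leq (i :: rem j s)).
have [_ ss _] := ms.
exists (sort leq (i :: rem j s)).
  have ss' := sort_sorted leq_total (i :: rem j s).
  have zs' : size (sort leq (i :: rem j s)) = size s.
    by rewrite size_sort (perm_size (perm_to_rem js)).
  apply: (seq_marker_down ms) => // l hl.
  (* Comparing counts avoids locating [i] in the sorted word. *)
  apply: nth_leq_of_count; rewrite ?zs' // => v.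
  by rewrite hp hp' /= leq_add2r; case: (leqP j v); case: (leqP i v); lia.
move=> x; rewrite hp' /=; have := hs x; rewrite hp /mulx /= (eq_sym j) (eq_sym i).
by lia.
Qed.

(** * Finiteness of the set of minimal markers *)

Definition minimal_marker s : Prop :=
  seq_marker J s /\ forall l, (l < size s)%N -> ~ seq_marker J (take l s).

Lemma exists_minimal_marker s : seq_marker J s ->
  exists2 l, (l <= size s)%N & minimal_marker (take l s).
Proof.
move: {2}(size s) (leqnn (size s)) => r; elim: r s => [|r IH] s hr ms.
  by exists (size s) => //; rewrite take_size; split=> // l; lia.
have [[l ls ml]|no] :=
    classic (exists2 l, (l < size s)%N & seq_marker J (take l s)).
  have zl : size (take l s) = l by rewrite size_takel // ltnW.
  have [||l' hl' ml'] := IH (take l s) => //; first by rewrite zl; lia.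
  rewrite zl in hl'; rewrite take_takel // in ml'; exists l' => //; lia.
exists (size s) => //; rewrite take_size; split=> // l ls ml.
by apply: no; exists l.
Qed.

(** Unlike the minimal markers, the live words are closed under prefixes, so they form a tree whose
    levels can be bounded one after the other. *)
Definition live s : Prop :=
  (exists t, [/\ sorted leq t, size t = m, take (size s) t = s & J (seq_hom t)]) /\
  forall l, (l < size s)%N -> ~ seq_marker J (take l s).

Lemma minimal_marker_live s : minimal_marker s -> live s.
Proof.
move=> [[sm ss hs] hmin]; split=> //.
pose t := mkseq (nth (last 0%N s) s) m.
have st : sorted leq t by apply/sorted_mkseq/nth_last_homo.
have zt : size t = m by rewrite size_mkseq.
have ht : take (size s) t = s.
  apply: take_eq_nth; rewrite ?zt // => i hi; rewrite nth_mkseq ?(leq_trans hi) //.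
  exact: set_nth_default.
by exists t; split=> //; apply: hs.
Qed.

(* Down-closure makes the next value after a non-marker prefix bounded. *)
Lemma live_rcons_bounded s : exists b, forall v, live (rcons s v) -> (v < b)%N.
Proof.
have [[t [st zt ht nJ]]|no] := classic (exists t,
    [/\ sorted leq t, size t = m, take (size s) t = s & ~ J (seq_hom t)]).
  (* A next letter beyond the last letter of [t] would put a word of [J] above [t], forcing [t] into
     [J]. *)
  exists (last 0%N t).+1 => v [[t' [st' zt' ht' Jt']] _].
  rewrite size_rcons in ht'; rewrite ltnS leqNgt; apply/negP => hv; apply: nJ.
  have hm : (size s < m)%N.
    have := congr1 size ht'; rewrite size_rcons size_take zt'.
    by case: ltnP => //; lia.
  apply: seq_hom_down Jt' => // i im; have [is_|is_] := ltnP i (size s).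
    have is1 : (i < (size s).+1)%N by apply: ltnW.
    by rewrite -(nth_take 0%N is_) ht -(nth_take 0%N is1 t') ht' nth_rcons is_.
  have hv' : nth 0%N t' (size s) = v.
    by rewrite -(@nth_take (size s).+1) // ht' nth_rcons ltnn eqxx.
  apply: (@leq_trans v); last first.
    by rewrite -hv'; apply: (sorted_leq_nth leq_trans leqnn); rewrite ?inE ?zt'.
  apply: (leq_trans _ (ltnW hv)); rewrite -nth_last zt.
  by apply: (sorted_leq_nth leq_trans leqnn); rewrite ?inE ?zt //; lia.
(* Here all extensions of [s] lie in [J], so [s] is a marker and has no live continuation. *)
exists 0%N => v [[t' [st' zt' ht' Jt']] hlive]; exfalso.
rewrite size_rcons in ht' hlive.
have ts : take (size s) t' = s.
  by rewrite -(@take_takel _ (size s) (size s).+1) // ht' -cats1 take_size_cat.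
apply: (hlive (size s) (ltnSn _)); rewrite -cats1 take_size_cat //; split.
- by have := congr1 size ts; rewrite size_take zt'; case: ltnP; lia.
- by rewrite -ts; apply: (subseq_sorted leq_trans (take_subseq _ _) st').
- by move=> t st zt ht; apply: NNPP => nJ; apply: no; exists t.
Qed.

Lemma live_finite r : exists l : seq (seq nat),
  forall s, size s = r -> live s -> s \in l.
Proof.
elim: r => [|r [l hl]]; first by exists [:: [::]] => s /size0nil ->.
have [b hb] : exists b, forall s, s \in l -> forall v, live (rcons s v) -> (v < b)%N.
  elim: l {hl} => [|s l [b hb]]; first by exists 0%N.
  have [b' hb'] := live_rcons_bounded s; exists (maxn b b') => s1.
  rewrite inE => /orP[/eqP ->|hs1] v hv; first by have := hb' v hv; lia.
  by have := hb s1 hs1 v hv; lia.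
exists [seq rcons s v | s <- l, v <- iota 0 b] => s.
case/lastP: s => [|s v] //; rewrite size_rcons => -[zs] hv.
have [[t [st zt ht Jt]] hmin] := hv; rewrite size_rcons in ht hmin.
have ls : live s.
  split=> [|i hi].
    exists t; split=> //.
    by rewrite -(@take_takel _ (size s) (size s).+1) // ht -cats1 take_size_cat.
  by have := hmin i (ltnW hi); rewrite -cats1 takel_cat // ltnW.
apply/allpairsP; exists (s, v); split=> //=; first exact: hl.
by rewrite mem_iota /= add0n; apply: hb hv; apply: hl.
Qed.

End PosetIdeal.
End Markers.

Lemma classic_filter (T : eqType) (P : T -> Prop) (l : seq T) :
  exists2 l', uniq l' & forall x, x \in l' <-> x \in l /\ P x.
Proof.
elim: l => [|y l [l' ul' hl']]; first by exists [::] => // x; split=> // -[].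
have [Py|nPy] := classic (P y).
  exists (undup (y :: l')); first exact: undup_uniq.
  move=> x; rewrite mem_undup !inE; split=> [/orP[/eqP ->|/hl' [-> Px]]|].
  - by rewrite eqxx.
  - by rewrite orbT.
  - by move=> [/orP[->//|xl] Px]; apply/orP; right; apply/hl'.
exists l' => // x; rewrite hl' inE; split=> [[-> Px]|[/orP[/eqP ->|->]]] //.
by rewrite orbT.
Qed.

Lemma minimal_markers_finite m (J : {ffun 'I_m -> nat} -> Prop) :
  hom_poset_ideal J ->
  exists2 L, uniq L & forall s, s \in L <-> minimal_marker J s.
Proof.
move=> HJ.
have [A hA] : exists A : seq (seq nat),
    forall s, (size s <= m)%N -> live J s -> s \in A.
  elim: {-2}m => [|r [A hA]].
    have [l hl] := live_finite HJ 0.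
    by exists l => s; rewrite leqn0 => /eqP; apply: hl.
  have [l hl] := live_finite HJ r.+1; exists (l ++ A) => s hs ls.
  rewrite mem_cat; move: hs; rewrite leq_eqVlt => /orP[/eqP zs|zs].
    by rewrite hl.
  by rewrite hA ?orbT.
have [L uL hL] := classic_filter (minimal_marker J) A; exists L => // s.
rewrite hL; split=> [[]//|ms]; split=> //.
by apply: hA (minimal_marker_live ms); case: ms => -[].
Qed.

(** This gives injectivity. An element of [J] is a marker with r = m; conversely a word of length m
    in the ideal extends its own marker prefix. *)
Lemma hom_Lp2 m (J : {ffun 'I_m -> nat} -> Prop) phi : hom_poset_ideal J ->
  J phi <-> isotone phi /\ Lp2 J (seq_exp (codom phi)).
Proof.
move=> HJ; split=> [Jphi|[iso]].
  have iso := HJ.1 _ Jphi; split=> //.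
  apply/Lp2_seq_markerP; first exact: monomial_seq_exp.
  exists (codom phi) => //; split; rewrite ?size_codom_ord //.
    exact: isotone_sorted.
  by move=> t _ zt; rewrite take_oversize ?zt // => ->; rewrite codom_ordK.
move=> /(Lp2_seq_markerP _ (monomial_seq_exp _))[s ms hs].
have st := isotone_sorted iso.
have [_ _ h] := seq_marker_prefix HJ ms st hs.
rewrite -[phi]codom_ordK; apply: h => //; first exact: size_codom_ord.
by rewrite size_takel ?(mdiv_seq_size hs).
Qed.

(** * Prefix-stable sets of words *)

Local Open Scope ring_scope.

Section SeqMonomial.
Variable n : nat.

Definition seq_mon (s : seq nat) : 'X_{1..n} := mon_of n (seq_exp s).

Lemma seq_monE s i : seq_mon s i = count_mem (i : nat) s.
Proof. by rewrite mnmE. Qed.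

Lemma seq_mon_cat s t : seq_mon (s ++ t) = (seq_mon s + seq_mon t)%MM.
Proof. by apply/mnmP=> i; rewrite mnmDE !seq_monE count_cat. Qed.

Lemma seq_mon_cons (i : 'I_n) (s : seq nat) :
  seq_mon ((i : nat) :: s) = (U_(i) + seq_mon s)%MM.
Proof. by apply/mnmP=> j; rewrite mnmDE mnm1E !seq_monE. Qed.

Lemma seq_mon_perm s t : perm_eq s t -> seq_mon s = seq_mon t.
Proof. by move=> /permP h; apply/mnmP=> i; rewrite !seq_monE h. Qed.

Lemma mdeg_seq_mon s : all (ltn^~ n) s -> mdeg (seq_mon s) = size s.
Proof.
elim: s => [_|x s IH /= /andP[xn /IH <-]].
  by apply/eqP; rewrite mdeg_eq0; apply/eqP/mnmP=> i; rewrite [LHS]mnmE [RHS]mnmE.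
by rewrite -[x]/(nat_of_ord (Ordinal xn)) seq_mon_cons mdegD mdeg1.
Qed.

Lemma exists_seq_mon (e : 'X_{1..n}) :
  exists s, [/\ sorted leq s, all (ltn^~ n) s & seq_mon s = e].
Proof.
pose u t := oapp (fun i : 'I_n => e i) 0%N (insub t).
have [|s ss hs] := @monomial_seq u.
  by exists n => i hi; rewrite /u insubF // ltnNge hi.
exists s; split=> //; last by apply/mnmP=> i; rewrite seq_monE hs /u valK.
apply/allP=> t ts; have : (0 < count_mem t s)%N by rewrite -has_count has_pred1.
by rewrite hs /u; case: insubP => // i ti _ _ /=.
Qed.

Lemma vars_ge_seq_mon c s : all (ltn^~ n) s -> vars_ge c (seq_mon s) ->
  all (leq c) s.
Proof.
move=> /allP sn h; apply/allP=> t ts; rewrite leqNgt; apply/negP=> tc.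
have := h (Ordinal (sn t ts)) tc; rewrite seq_monE => /eqP.
by rewrite -leqn0 leqNgt -has_count has_pred1 ts.
Qed.

End SeqMonomial.

Lemma sorted_cat_last s w : sorted leq s -> sorted leq w ->
  all (leq (last 0%N s)) w -> sorted leq (s ++ w).
Proof.
case: s => // x s /= ps sw hw; rewrite cat_path ps /=.
by case: w sw hw => //= y w -> /andP[->].
Qed.

Lemma sorted_leq_last s x : sorted leq s -> x \in s -> (x <= last 0%N s)%N.
Proof.
move=> ss xs; rewrite -(nth_index 0%N xs) -nth_last.
have : (index x s < size s)%N by rewrite index_mem.
by move=> h; apply: (sorted_leq_nth leq_trans leqnn); rewrite ?inE; lia.
Qed.

Lemma leq_mem_sumn (x : nat) w : x \in w -> (x <= sumn w)%N.
Proof.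
elim: w => //= y w IH; rewrite inE => /orP[/eqP ->|/IH]; lia.
Qed.

Section Regular.
Variables (k : fieldType) (n reg : nat) (L : seq (seq nat)).
Hypothesis L_uniq : uniq L.
Hypothesis L_sorted : forall s, s \in L ->
  [/\ sorted leq s, all (ltn^~ n) s & (size s <= reg)%N].
Hypothesis L_prefix : forall s s' l, s \in L -> s' \in L -> take l s' = s -> s = s'.
Hypothesis L_stable : forall s i, s \in L ->
  exists2 l, (l <= size s)%N & take l (sort leq (i :: s)) \in L.

Local Notation gs := [seq seq_exp s | s <- L].
Local Notation S := {mpoly k[n]}.
Let gen (j : 'I_(size gs)) : seq nat := nth [::] L j.

Let gen_lt (j : 'I_(size gs)) : (j < size L)%N.
Proof. by rewrite -(size_map seq_exp L). Qed.

Let gen_in j : gen j \in L.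
Proof. exact: mem_nth. Qed.

Let gen_rowE j : gen_row k n gs ord0 j = 'X_[seq_mon n (gen j)].
Proof.
by rewrite mxE (nth_map [::]).
Qed.

Let gen_surj s : s \in L -> exists j, gen j = s.
Proof.
move=> sL; have h : (index s L < size gs)%N by rewrite size_map index_mem.
by exists (Ordinal h); rewrite /gen nth_index.
Qed.

Let mul_gen_row (v : 'cV[S]_(size gs)) :
  (gen_row k n gs *m v) ord0 ord0 = \sum_j v j ord0 * 'X_[seq_mon n (gen j)].
Proof. by rewrite mxE; apply: eq_bigr => j _; rewrite gen_rowE mulrC. Qed.

Let gen_row_delta (p : S) j :
  (gen_row k n gs *m (p *: (delta_mx j ord0 : 'cV[S]_(size gs)))) ord0 ord0 =
  p * 'X_[seq_mon n (gen j)].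
Proof. by rewrite -scalemxAr mxE -colE mxE gen_rowE. Qed.

(* If [w] and [w'] only involve letters beyond the last letters of [s] and
   [s'] and [s w = s' w'] as monomials, then [s ++ w] and [s' ++ w'] are the
   same sorted word, so one of [s], [s'] is a prefix of the other. *)
Lemma gen_mon_inj j j' e e' :
  vars_ge (last 0%N (gen j)) e -> vars_ge (last 0%N (gen j')) e' ->
  (e' + seq_mon n (gen j') = seq_mon n (gen j) + e)%MM -> j' = j.
Proof.
have [w [sw wn <-]] := exists_seq_mon e; have [w' [sw' wn' <-]] := exists_seq_mon e'.
move=> /(vars_ge_seq_mon wn) hw /(vars_ge_seq_mon wn') hw'.
have [ss sn _] := L_sorted (gen_in j); have [ss' sn' _] := L_sorted (gen_in j').
rewrite addmC -!seq_mon_cat => heq.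
have hp : gen j ++ w = gen j' ++ w'.
  apply: (sorted_eq leq_trans anti_leq); try exact: sorted_cat_last.
  apply/allP=> t _ /=; apply/eqP; have [tn|tn] := ltnP t n.
    by have /mnmP/(_ (Ordinal tn)) := esym heq; rewrite !seq_monE.
  have h0 s : all (ltn^~ n) s -> count_mem t s = 0%N.
    move=> /allP hs; apply/count_memPn; apply/negP => /hs.
    by rewrite /= ltnNge tn.
  by rewrite !h0 // all_cat ?sn ?sn' ?wn ?wn'.
suff eg : gen j' = gen j.
  by apply/val_inj/eqP; rewrite -(nth_uniq [::] (gen_lt _) (gen_lt _) L_uniq); apply/eqP.
have [hle|hle] := leqP (size (gen j)) (size (gen j')).
  apply/esym/(L_prefix (l := size (gen j)) (gen_in _) (gen_in _)).
  by rewrite -(takel_cat w' hle) -hp take_size_cat.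
apply/(L_prefix (l := size (gen j')) (gen_in _) (gen_in _)).
by rewrite -(takel_cat w (ltnW hle)) hp take_size_cat.
Qed.

(** Uniqueness is [gen_mon_inj]. For the rewriting, [L_stable] gives the sorted word of x_i h_j a
    prefix in [L], and the remaining letters form the multiplicative cofactor. *)
Lemma involutive_gen_row :
  involutive_basis (gen_row k n gs) (fun j => last 0%N (gen j))
    (fun j => sumn (gen j)) (fun j => size (gen j)).
Proof.
split=> [v hv /matrixP/(_ ord0 ord0)|j i ilast].
  rewrite mul_gen_row [RHS]mxE => s0; apply/colP=> j; rewrite mxE.
  apply/mpolyP=> e; rewrite mcoeff0.
  case: (boolP (e \in msupp (v j ord0))) => [he|]; last first.
    by rewrite -mcoeff_eq0 => /eqP.
  have /(congr1 (mcoeff (seq_mon n (gen j) + e)%MM)) := s0.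
  rewrite mcoeff0 mcoeff_sum (bigD1 j) //= mcoeffMX big1 ?addr0 // => j' jj'.
  apply: mcoeff_mulX_eq0 => e' he' heq; case/eqP: jj'.
  exact: gen_mon_inj (hv j e he) (hv j' e' he') heq.
have [ss sn _] := L_sorted (gen_in j).
have [l ls hl] := L_stable i (gen_in j).
set t := sort leq _ in hl.
have pt : perm_eq t ((i : nat) :: gen j) by apply/permEl/perm_sort.
have st : sorted leq t by apply: sort_sorted leq_total _.
have tn : all (ltn^~ n) t by rewrite (perm_all _ pt) /= ltn_ord.
have zt : size t = (size (gen j)).+1 by rewrite (perm_size pt).
have [j' hj'] := gen_surj hl.
have td : t = gen j' ++ drop l t by rewrite hj' cat_take_drop.
set w := drop l t in td.
have wn : all (ltn^~ n) w by move: tn; rewrite td all_cat => /andP[].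
have sw : sorted leq w by apply: (subseq_sorted leq_trans (drop_subseq _ _) st).
have hmon : (U_(i) + seq_mon n (gen j) = seq_mon n w + seq_mon n (gen j'))%MM.
  by rewrite -seq_mon_cons -(seq_mon_perm _ pt) td seq_mon_cat addmC.
exists ('X_[seq_mon n w] *: delta_mx j' ord0); split.
  apply/matrixP=> a b; rewrite !ord1 mulmxBr mxE [X in _ + X]mxE !gen_row_delta.
  by rewrite -!mpolyXD hmon subrr mxE.
move=> j1; rewrite !mxE eqxx andbT; case: eqP => [->|_]; last first.
  by rewrite mulr0; apply: supp_in0.
rewrite mulr1; apply: supp_inX; split; last split.
- move=> x hx; rewrite seq_monE; apply/count_memPn/negP => xw.
  move: st; rewrite td; case E: (gen j') hx => [|y s] //= hx.
  rewrite cat_path => /andP[_ /(order_path_min leq_trans)/allP/(_ _ xw)].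
  by rewrite leqNgt hx.
(* The letter sum drops: [w] contains the last letter of [t], which is at least the last letter of
   [gen j] and so exceeds [i]. *)
- have hs : (i + sumn (gen j) = sumn (gen j') + sumn w)%N.
    by rewrite -sumn_cat -td !sumnE (perm_big _ pt) big_cons.
  have : (last 0%N (gen j) <= sumn w)%N; last by lia.
  have gl : last 0%N (gen j) \in gen j.
    by case: (gen j) ilast => // x s _; apply: mem_last.
  have : (last 0%N (gen j) <= last 0%N t)%N.
    by apply: sorted_leq_last; rewrite // (perm_mem pt) inE gl orbT.
  move=> h; apply: leq_trans h (leq_mem_sumn _).
  (* [w] is nonempty because [l <= size (gen j)] and [t] is one letter longer. *)
  have : (0 < size w)%N by rewrite size_drop zt subn_gt0.
  rewrite td last_cat; case: (w) => // x s _; exact: mem_last.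
- rewrite mdeg_seq_mon // -zt [in RHS]td size_cat; exact: addnC.
Qed.

Lemma prefix_stable_regular : has_regular_resolution (gen_row k n gs) reg.
Proof.
apply: (involutive_has_regular_resolution involutive_gen_row) => j; last first.
  by have [] := L_sorted (gen_in j).
have [_ sn _] := L_sorted (gen_in j).
by rewrite gen_rowE /homog_deg msuppX /= mdeg_seq_mon // eqxx.
Qed.

End Regular.

(** * Degrees of generators of a regular monomial ideal *)

Lemma InP (gs : seq (nat -> nat)) g d :
  List.In g gs <-> exists2 j, (j < size gs)%N & nth d gs j = g.
Proof.
elim: gs g => [|h gs IH] g /=; first by split=> // -[].
split=> [[->|/IH[j hj <-]]|[[|j] hj <-]].
- by exists 0%N.
- by exists j.+1.
- by left.
- by right; apply/IH; exists j.
Qed.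

(** The generators of F_0 map to forms of degree at most [reg]. Some monomial of such a form divides
    [g]; as the form lies in a monomial ideal, that monomial is in turn divisible by some [g']. *)
Lemma regular_resolution_low_degree (k : fieldType) n reg
    (gs : seq (nat -> nat)) g :
  has_regular_resolution (gen_row k n gs) reg ->
  (forall g, List.In g gs -> forall i, (n <= i)%N -> g i = 0%N) ->
  List.In g gs ->
  exists s, [/\ sorted leq s, (size s <= reg)%N, mdivides (seq_exp s) g &
    exists2 g', List.In g' gs & mdivides g' (seq_exp s)].
Proof.
move=> [r [deg [h [_ [_ [hid [hhom [_ [_ [_ hdeg]]]]]]]]]] gsn hg.
have mem_gen a (G : 'rV[{mpoly k[n]}]_a) j : in_ideal_gen G (G ord0 j).
  by exists (delta_mx j ord0); rewrite -colE mxE.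
have supp_gen a (G : 'rV[{mpoly k[n]}]_a) p e : in_ideal_gen G p ->
    e \in msupp p -> exists j e1 e2, e1 \in msupp (G ord0 j) /\ e = (e1 + e2)%MM.
  move=> [v ->]; rewrite mxE => /msupp_sum_le /flattenP[t /mapP[j _ ->]].
  move=> /msuppM_le /allpairsP[[e1 e2] /= [h1 _ ->]].
  by exists j, e1, e2.
pose d0 := (fun=> 0%N) : nat -> nat.
have [j hj ejg] := (InP gs g d0).1 hg.
have hX : in_ideal_gen h 'X_[mon_of n g].
  apply/hid; rewrite -ejg.
  by have := mem_gen _ (gen_row k n gs) (Ordinal hj); rewrite mxE.
have [|i [e1 [e2 [he1 ee]]]] := supp_gen _ _ _ (mon_of n g) hX.
  by rewrite msuppX mem_head.
have [j' [e3 [e4]]] := supp_gen _ _ _ e1 ((hid _).2 (mem_gen _ h i)) he1.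
rewrite mxE => -[/mem_msuppXP <-] ee1.
have hIn : List.In (nth d0 gs j') gs by apply/InP; exists j'.
have [s [ss sn es]] := exists_seq_mon e1.
exists s; split=> //.
- rewrite -(mdeg_seq_mon sn) es; have /allP/(_ _ he1)/eqP -> := hhom i.
  by have := hdeg 0%N i; rewrite addn0.
- move=> t; have [tn|tn] := ltnP t n; last first.
    rewrite [seq_exp s t](_ : _ = 0%N) //; apply/count_memPn/negP.
    by move=> /(allP sn) /=; rewrite ltnNge tn.
  have := congr1 (fun e : 'X_{1..n} => e (Ordinal tn)) ee.
  by rewrite mnmDE -es seq_monE mnmE /= => ->; apply: leq_addr.
- exists (nth d0 gs j') => // t; have [tn|tn] := ltnP t n; last first.
    by rewrite (gsn _ hIn).
  have := congr1 (fun e : 'X_{1..n} => e (Ordinal tn)) ee1.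
  by rewrite -es seq_monE mnmDE mnmE /seq_exp /= => ->; apply: leq_addr.
Qed.

(** * The correspondence *)

Local Open Scope nat_scope.

Lemma In_mapP (T : eqType) (f : T -> nat -> nat) (l : seq T) g :
  List.In g [seq f s | s <- l] <-> exists2 s, s \in l & g = f s.
Proof.
elim: l g => [|x l IH] g /=; first by split=> // -[].
split=> [[<-|/IH[s sl ->]]|[s]].
- by exists x; rewrite ?mem_head.
- by exists s => //; rewrite inE sl orbT.
- rewrite inE => /orP[/eqP -> ->|sl ->]; first by left.
  by right; apply/IH; exists s.
Qed.

Lemma Lp2_generates m (J : {ffun 'I_m -> nat} -> Prop) L :
  hom_poset_ideal J -> (forall s, s \in L <-> minimal_marker J s) ->
  generates (Lp2 J) [seq seq_exp s | s <- L].
Proof.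
move=> HJ hL; split=> [g /In_mapP[s _ ->]|u]; first exact: monomial_seq_exp.
split=> [hu|[mu [g /In_mapP[s /hL[ms _] ->] hdiv]]]; last first.
  by apply/(Lp2_seq_markerP J mu); exists s.
have mu := Lp2_monomial hu; split=> //.
have [s ms hs] := (Lp2_seq_markerP J mu).1 hu.
have [t st ht] := monomial_seq mu.
have hst : mdiv_seq s t by move=> x; rewrite ht.
have [l _ hl] := exists_minimal_marker (seq_marker_prefix HJ ms st hst).
exists (seq_exp (take l (take (size s) t))).
  by apply/In_mapP; exists (take l (take (size s) t)) => //; apply/hL.
move=> x; rewrite -ht; apply: leq_count_subseq.
exact: subseq_trans (take_subseq _ _) (take_subseq _ _).
Qed.

Lemma Lp2_regular (k : fieldType) m (J : {ffun 'I_m -> nat} -> Prop) :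
  hom_poset_ideal J -> fg_strongly_stable_regular k m (Lp2 J).
Proof.
move=> HJ; have [L uL hL] := minimal_markers_finite HJ.
have hgen := Lp2_generates HJ hL.
pose n := (\max_(x <- flatten L) x).+1.
have Ln s : s \in L -> all (ltn^~ n) s.
  move=> sL; apply/allP=> x xs; rewrite /= /n ltnS.
  by apply: (leq_bigmax_seq (F := id)) => //; apply/flattenP; exists s.
split; first by exists [seq seq_exp s | s <- L].
split; first exact: Lp2_strongly_stable.
exists [seq seq_exp s | s <- L], n; split=> //; split.
  move=> g /In_mapP[s sL ->] i ni; apply/count_memPn/negP.
  by move=> /(allP (Ln s sL)) /=; rewrite ltnNge ni.
apply: prefix_stable_regular => //.
- by move=> s sL; have /hL[[sm ss _] _] := sL; split=> //; apply: Ln.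
- move=> s s' l /hL[ms _] /hL[_ hmin] hs.
  have [ls|ls] := ltnP l (size s'); last by rewrite -hs take_oversize.
  by case: (hmin l ls); rewrite hs.
(* [s] divides the sorted word [t], so the first [size s] letters of [t] form a marker, and one of
   its prefixes is minimal. *)
- move=> s i /hL[ms _]; pose t := sort leq (i :: s).
  have hst : mdiv_seq s t.
    by move=> x; rewrite (permP (permEl (perm_sort _ _))) leq_addl.
  have st : sorted leq t by apply: sort_sorted leq_total _.
  have [l] := exists_minimal_marker (seq_marker_prefix HJ ms st hst).
  rewrite size_takel ?(mdiv_seq_size hst) // => ls; rewrite take_takel // => hl.
  by exists l => //; apply/hL.
Qed.

(** The letters are lowered one at a time; [acc] collects those already treated. *)
Lemma strongly_stable_down M (acc s s' : seq nat) : strongly_stable M ->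
  (forall u v, u =1 v -> M u -> M v) -> size s' = size s ->
  (forall i, nth 0 s' i <= nth 0 s i) ->
  M (seq_exp (acc ++ s)) -> M (seq_exp (acc ++ s')).
Proof.
move=> hM hext; elim: s s' acc => [|x s IH] [|x' s'] acc //= [zs] h.
have hx : forall y l, seq_exp (acc ++ y :: l) =1 mulx y (seq_exp (acc ++ l)).
  by move=> y l t; rewrite /mulx /seq_exp !count_cat /= (eq_sym y); lia.
have hr : forall l, seq_exp (acc ++ x' :: l) =1 seq_exp (rcons acc x' ++ l).
  by move=> l t; rewrite cat_rcons.
move=> Ms.
apply: (hext _ _ (fun t => esym (hr _ t))); apply: IH => // [i|]; first exact: (h i.+1).
apply: (hext _ _ (hr _)).
have := h 0; rewrite leq_eqVlt /= => /orP[/eqP -> //|hlt].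
apply: (hext _ _ (fun t => esym (hx _ _ t))).
apply: (hM _ _ _ _ hlt); first exact: monomial_seq_exp.
exact: (hext _ _ (hx _ _) Ms).
Qed.

(** [J] consists of the isotone maps whose word, read as a monomial, lies in [M]; strong stability
    makes it closed downwards. *)
Lemma Lp2_surjective (k : fieldType) m (M : (nat -> nat) -> Prop) :
  fg_strongly_stable_regular k m M ->
  exists J : {ffun 'I_m -> nat} -> Prop,
    hom_poset_ideal J /\ forall u, M u <-> Lp2 J u.
Proof.
move=> [_ [hM [gs [n [[gmon hgen] [gsn hres]]]]]].
have hext u v : u =1 v -> M u -> M v.
  move=> uv /hgen[[N hN] [g hg gu]]; apply/hgen; split.
    by exists N => i hi; rewrite -uv hN.
  by exists g => // t; rewrite -uv.
pose J (phi : {ffun 'I_m -> nat}) := isotone phi /\ M (seq_exp (codom phi)).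
exists J; split.
  split=> [phi []//|phi psi [iso Mphi] iso' le]; split=> //.
  apply: (@strongly_stable_down M [::] (codom phi)) Mphi => //.
    by rewrite !size_codom_ord.
  move=> i; have [im|im] := ltnP i m; last by rewrite nth_default ?size_codom_ord.
  by rewrite -[i]/(val (Ordinal im)) !nth_codom_ord.
move=> u; split=> [Mu|].
  have [mu [g hg gu]] := (hgen u).1 Mu.
  (* Regularity provides a monomial of [M] of degree at most m dividing [u]; all its extensions to
     length m stay in [M], so it is a marker. *)
  have [s [ss zs sg [g' hg' g's]]] := regular_resolution_low_degree hres gsn hg.
  apply/(Lp2_seq_markerP J mu); exists s; last by move=> x; apply: leq_trans (sg x) (gu x).
  split=> // t st zt ht; split; first exact: isotone_seq_hom.
  apply/hgen; split; first exact: monomial_seq_exp.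
  exists g' => // x; apply: leq_trans (g's x) _.
  by rewrite seq_homK // -ht; apply: leq_count_subseq; apply: take_subseq.
move=> hu; have mu := Lp2_monomial hu.
have [s [sm ss hs] su] := (Lp2_seq_markerP J mu).1 hu.
(* Fill up the marker with a variable occurring in no generator. *)
pose N := maxn n (last 0 s).
have N_last : all (leq (last 0 s)) (nseq (m - size s) N).
  by apply/allP=> x /nseqP[-> _]; apply: leq_maxr.
have st : sorted leq (s ++ nseq (m - size s) N).
  apply: sorted_cat_last => //; apply/(sortedP 0) => i; rewrite size_nseq => hi.
  by rewrite !nth_nseq hi (ltnW hi).
have zt : size (s ++ nseq (m - size s) N) = m by rewrite size_cat size_nseq subnKC.
have [iso] := hs _ st zt (take_size_cat _ (erefl _)).
rewrite seq_homK // => /hgen[_ [g hg gs_]]; apply/hgen; split=> //; exists g => // x.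
have [xn|xn] := ltnP x n; last by rewrite (gsn g hg).
apply: leq_trans (gs_ x) (leq_trans _ (su x)).
rewrite /seq_exp count_cat count_nseq /=.
by have -> : (N == x) = false by [apply/negbTE/eqP; rewrite /N; lia]; rewrite addn0.
Qed.

Theorem theorem6p2 (k : fieldType) (m : nat) (hm : (1 <= m)%N) :
  (* L^{p2}([m], J) is a finitely generated strongly stable m-regular ideal *)
  (forall J : {ffun 'I_m -> nat} -> Prop,
      hom_poset_ideal J -> fg_strongly_stable_regular k m (Lp2 J)) /\
  (* injectivity of J |-> L^{p2}([m], J) *)
  (forall J1 J2 : {ffun 'I_m -> nat} -> Prop,
      hom_poset_ideal J1 -> hom_poset_ideal J2 ->
      (forall u, Lp2 J1 u <-> Lp2 J2 u) -> forall phi, J1 phi <-> J2 phi) /\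
  (* surjectivity onto finitely generated strongly stable m-regular ideals *)
  (forall M : (nat -> nat) -> Prop,
      fg_strongly_stable_regular k m M ->
      exists J : {ffun 'I_m -> nat} -> Prop,
        hom_poset_ideal J /\ forall u, M u <-> Lp2 J u).
Proof.
split; first by move=> J; apply: Lp2_regular.
split; last by move=> M; apply: Lp2_surjective.
move=> J1 J2 HJ1 HJ2 h phi.
by rewrite (hom_Lp2 phi HJ1) (hom_Lp2 phi HJ2) h.
Qed.
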